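(* Let $R$ be a right non-singular ring and consider a commutative diagram of right $R$-modules and right $R$-module morphisms with $e$-exact rows $A_1 \xrightarrow{f_1} A_2 \xrightarrow{f_2} A_3 \xrightarrow{f_3} A_4\xrightarrow{f_4} A_5$ and $B_1 \xrightarrow{g_1} B_2 \xrightarrow{g_2} B_3 \xrightarrow{g_3} B_4\xrightarrow{g_4} B_5$ and vertical morphisms $t_i\colon A_i\to B_i$ ($i=1,\dots,5$), so that $t_{i+1}f_i=g_it_i$ for $i=1,2,3,4$. Suppose that $B_3$ is a non-singular right $R$-module. (1) If $t_2$ and $t_4$ are $e$-epis, and $t_5$ is monic, then $t_3$ is $e$-epi. (2) If $t_1$ is $e$-epi and $t_2,t_4$ are monic, then $\ker(t_3)$ is singular. In particular, if $A_3$ is non-singular, then $t_3$ is monic.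
   Context: Rings are associative with identity $1\neq 0$, not necessarily commutative; modules are unitary right modules. A submodule $N\le M$ is essential in $M$ if $N\cap X\neq 0$ for every nonzero submodule $X$ of $M$. A cochain complex $\cdots\to M^{i-1}\xrightarrow{f^{i-1}}M^i\xrightarrow{f^i}M^{i+1}\to\cdots$ of right $R$-modules (so $f^if^{i-1}=0$) is $e$-exact if $f^{i-1}(M^{i-1})$ is an essential submodule of $\ker(f^i)$ for every $i$; for a finite row the condition is imposed at every term having both an incoming and an outgoing map in the row. A morphism $f\colon A\to B$ is $e$-epi if $f(A)$ is essential in $B$. For a right $R$-module $M$, the singular submodule is $Z(M)=\{x\in M \mid xI=0 \text{ for some essential right ideal } I \text{ of } R\}$; $M$ is singular if $Z(M)=M$ and non-singular if $Z(M)=0$. The ring $R$ is right non-singular if $Z(R_R)=0$. *)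

(* Defs.v *)
From HB Require Import structures.
From mathcomp Require Import all_boot all_order all_algebra.
From mathcomp Require Import boolp classical_sets.

Set Implicit Arguments.
Unset Strict Implicit.
Unset Printing Implicit Defensive.

Import GRing.Theory.
Local Open Scope ring_scope.
Local Open Scope classical_set_scope.

(* MathComp modules are left modules, so a right R-module is a left module
   over the converse ring R^c, with x . r written (r : R^c) *: x. *)
Notation rmodType R := (lmodType R^c).

(* R_R; its submodules are the right ideals of R. *)
Definition regular_rmod (R : nzRingType) : rmodType R := (R^c)^o.

Lemma regular_rmod_scaleE (R : nzRingType) (r : R^c) (x : regular_rmod R) :
  r *: x = ((x : R) * (r : R) : R).
Proof. by []. Qed.

Definition submodule (R : nzRingType) (M : rmodType R) (N : set M) :=
  submod_closed (mem N).

Lemma submoduleP (R : nzRingType) (M : rmodType R) (N : set M) :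
  submodule N <->
  N 0 /\ forall (r : R^c) x y, N x -> N y -> N (r *: x + y).
Proof.
split=> -[N0 NZD]; split.
- by move: N0; rewrite inE.
- by move=> r x y Nx Ny; move: (NZD r x y); rewrite !inE; apply.
- by rewrite inE.
- by move=> r x y; rewrite !inE; apply: NZD.
Qed.

(* N is an essential submodule of the submodule K of M. *)
Definition essential (R : nzRingType) (M : rmodType R) (N K : set M) :=
  [/\ submodule N, N `<=` K
    & forall X : set M,
        submodule X -> X `<=` K -> X <> [set 0] -> N `&` X <> [set 0]].

Definition kernel (R : nzRingType) (M N : rmodType R) (f : {linear M -> N}) :
  set M := [set x | f x = 0].

Definition e_exact_at (R : nzRingType) (L M N : rmodType R)
    (f : {linear L -> M}) (g : {linear M -> N}) :=
  (forall x, g (f x) = 0) /\ essential (range f) (kernel g).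

Definition e_epi (R : nzRingType) (M N : rmodType R) (f : {linear M -> N}) :=
  essential (range f) [set: N].

Definition essential_right_ideal (R : nzRingType) (I : set (regular_rmod R)) :=
  essential I [set: regular_rmod R].

(* Z(N), for N a submodule of M; the case of M itself is N = [set: M]. *)
Definition singular_submodule (R : nzRingType) (M : rmodType R) (N : set M) :
    set M :=
  [set x | N x /\ exists2 I : set (regular_rmod R), essential_right_ideal I
             & forall r : R^c, I r -> r *: x = 0].

Definition singular (R : nzRingType) (M : rmodType R) (N : set M) :=
  singular_submodule N = N.

Definition nonsingular (R : nzRingType) (M : rmodType R) (N : set M) :=
  singular_submodule N = [set 0].

Definition right_nonsingular (R : nzRingType) :=
  nonsingular [set: regular_rmod R].

(* Main.v *)
(* If N is essential in K and x lies in K, then (N : x) = {r | xr in N} is an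
   essential right ideal, and a nonzero element y of a non-singular module is
   not annihilated by it: some r satisfies xr in N and yr <> 0.  Both parts are
   diagram chases in which every lift that exactness or surjectivity would give
   exists only after multiplication by such an r.  In (1) the multipliers are
   chosen so as to keep a given nonzero element of B3 alive; in (2) so as to
   keep a given nonzero element of R alive, which shows that the annihilator of
   an element of ker(t3) is essential. *)
Require Import Defs.
From HB Require Import structures.
From mathcomp Require Import all_boot all_order all_algebra.
From mathcomp Require Import boolp classical_sets.
Import GRing.Theory.
Local Open Scope ring_scope.
Local Open Scope classical_set_scope.

Set Implicit Arguments.
Unset Strict Implicit.

Lemma submodule_kernel (R : nzRingType) (M N : rmodType R)
  (f : {linear M -> N}) : submodule (kernel f).
Proof.
apply/submoduleP; split=> [|r x y]; rewrite /kernel /= ?linear0// => fx fy.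
by rewrite linearP fx fy scaler0 addr0.
Qed.

Lemma submodule_range (R : nzRingType) (M N : rmodType R)
  (f : {linear M -> N}) : submodule (range f).
Proof.
apply/submoduleP; split=> [|r _ _ [x _ <-] [y _ <-]].
  by exists 0; rewrite ?linear0.
by exists (r *: x + y); rewrite ?linearP.
Qed.

Lemma submodule_setT (R : nzRingType) (M : rmodType R) : submodule [set: M].
Proof. exact/submoduleP. Qed.

Lemma submoduleZ (R : nzRingType) (M : rmodType R) (N : set M) (r : R^c) x :
  submodule N -> N x -> N (r *: x).
Proof. by move=> /submoduleP[N0 NZD] Nx; rewrite -[_ *: _]addr0; apply: NZD. Qed.

Lemma submodule_neq0P (R : nzRingType) (M : rmodType R) (N : set M) :
  submodule N -> N <> [set 0] <-> exists2 x, N x & x <> 0.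
Proof.
move=> /submoduleP[N0 _]; split=> [NN0|[x Nx x0] N0E]; last first.
  by apply: x0; move: Nx; rewrite N0E.
apply: contrapT => noN; apply: NN0; apply/seteqP; split=> x /= => [Nx|->//].
by apply: contrapT => x0; apply: noN; exists x.
Qed.

Lemma submoduleI (R : nzRingType) (M : rmodType R) (N X : set M) :
  submodule N -> submodule X -> submodule (N `&` X).
Proof.
move=> /submoduleP[N0 NZD] /submoduleP[X0 XZD].
apply/submoduleP; split=> // r x y [Nx Xx] [Ny Xy].
by split; [apply: NZD|apply: XZD].
Qed.

(** The cyclic submodule generated by [x] is nonzero and lies in [K], so it meets [N] nontrivially.
    With the converse [elem_essential], essentiality is tested on elements. *)
Lemma essential_elem (R : nzRingType) (M : rmodType R) (N K : set M) x :
  submodule K -> essential N K -> K x -> x <> 0 ->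
  exists r : R^c, N (r *: x) /\ r *: x <> 0.
Proof.
move=> sK [sN _ essN] Kx x0.
have sX : submodule (range (fun r : R^c => r *: x)).
  apply/submoduleP; split=> [|r _ _ [a _ <-] [b _ <-]].
    by exists 0; rewrite ?scale0r.
  by exists (r * a + b); rewrite // scalerDl scalerA.
have /(submodule_neq0P (submoduleI sN sX))[y [+ [r _ rxE]]] :
    N `&` range (fun r : R^c => r *: x) <> [set 0].
  apply: essN => // [_ [r _ <-]|]; first exact: submoduleZ.
  by apply/(submodule_neq0P sX); exists x => //; exists 1; rewrite ?scale1r.
by rewrite -rxE => Nrx rx0; exists r.
Qed.

Lemma elem_essential (R : nzRingType) (M : rmodType R) (N K : set M) :
  submodule N -> N `<=` K ->
  (forall x, K x -> x <> 0 -> exists r : R^c, N (r *: x) /\ r *: x <> 0) ->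
  essential N K.
Proof.
move=> sN NK essN; split=> // X sX XK /(submodule_neq0P sX)[x Xx x0].
have [r [Nrx rx0]] := essN x (XK x Xx) x0.
apply/(submodule_neq0P (submoduleI sN sX)); exists (r *: x) => //.
by split=> //; apply: submoduleZ.
Qed.

Lemma essential_colon (R : nzRingType) (M : rmodType R) (N K : set M) x :
  submodule K -> essential N K -> K x ->
  essential_right_ideal [set r : regular_rmod R | N ((r : R^c) *: x)].
Proof.
move=> sK essN Kx; have [sN _ _] := essN.
have /submoduleP[N0 NZD] := sN.
apply: elem_essential => //.
  apply/submoduleP; split=> /= [|r a b Na Nb]; first by rewrite scale0r.
  by rewrite scalerDl -scalerA; apply: NZD.
(* If [y] kills [x], then [y] itself lies in the colon ideal. Otherwise a multiple of [y *: x] in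
   [N] is nonzero, which forces the same multiple of [y] to be nonzero. *)
move=> y _ y0; have [yx0|/eqP yx0] := eqVneq ((y : R^c) *: x) 0.
  by exists 1; rewrite /= scale1r yx0.
have [c [Nc c0]] := essential_elem sK essN (submoduleZ (y : R^c) sK Kx) yx0.
exists c; split=> /=; first by rewrite -scalerA.
by move=> cy0; apply: c0; rewrite scalerA [c * y]cy0 scale0r.
Qed.

(** If no such [r] existed, the essential right ideal of [essential_colon] would annihilate [y]. The
    elements [x] and [y] may live in unrelated modules: [x] is what gets lifted, [y] is what must
    survive. *)
Lemma nonsingular_colon (R : nzRingType) (M P : rmodType R) (N K : set M) x
    (y : P) :
  nonsingular [set: P] -> submodule K -> essential N K -> K x -> y <> 0 ->
  exists r : R^c, N (r *: x) /\ r *: y <> 0.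
Proof.
move=> nsP sK essN Kx y0; apply: contrapT => nor; apply: y0.
suff : singular_submodule [set: P] y by rewrite nsP.
split=> //; exists [set r : regular_rmod R | N ((r : R^c) *: x)].
  exact: essential_colon Kx.
by move=> r /= Nr; apply: contrapT => ry0; apply: nor; exists r.
Qed.

Lemma linear_inj_ker (R : nzRingType) (M N : rmodType R) (f : {linear M -> N}) :
  injective f <-> forall x, f x = 0 -> x = 0.
Proof.
split=> [injf x fx|kerf x y fxy]; first by apply: injf; rewrite linear0.
by apply/eqP; rewrite -subr_eq0; apply/eqP/kerf; rewrite linearB fxy subrr.
Qed.

Lemma nonsingular_sub (R : nzRingType) (M : rmodType R) (N : set M) :
  nonsingular [set: M] -> singular N -> forall x, N x -> x = 0.
Proof.
move=> nsM sgN x; rewrite -sgN => -[_ annx].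
by suff : singular_submodule [set: M] x by rewrite nsM.
Qed.

Theorem proposition3p2 (R : nzRingType) (A1 A2 A3 A4 A5 : rmodType R)
  (B1 B2 B3 B4 B5 : rmodType R)
  (f1 : {linear A1 -> A2}) (f2 : {linear A2 -> A3})
  (f3 : {linear A3 -> A4}) (f4 : {linear A4 -> A5})
  (g1 : {linear B1 -> B2}) (g2 : {linear B2 -> B3})
  (g3 : {linear B3 -> B4}) (g4 : {linear B4 -> B5})
  (t1 : {linear A1 -> B1}) (t2 : {linear A2 -> B2}) (t3 : {linear A3 -> B3})
  (t4 : {linear A4 -> B4}) (t5 : {linear A5 -> B5})
  (hR : right_nonsingular R)
  (hA2 : e_exact_at f1 f2) (hA3 : e_exact_at f2 f3) (hA4 : e_exact_at f3 f4)
  (hB2 : e_exact_at g1 g2) (hB3 : e_exact_at g2 g3) (hB4 : e_exact_at g3 g4)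
  (c1 : forall x, t2 (f1 x) = g1 (t1 x))
  (c2 : forall x, t3 (f2 x) = g2 (t2 x))
  (c3 : forall x, t4 (f3 x) = g3 (t3 x))
  (c4 : forall x, t5 (f4 x) = g4 (t4 x))
  (nsB3 : nonsingular [set: B3]) :
  (e_epi t2 -> e_epi t4 -> injective t5 -> e_epi t3) /\
  (e_epi t1 -> injective t2 -> injective t4 ->
     singular (kernel t3) /\ (nonsingular [set: A3] -> injective t3)).
Proof.
have [f21 _] := hA2; have [_ eA3] := hA3; have [_ eA4] := hA4.
have [_ eB2] := hB2; have [_ eB3] := hB3; have [g43 _] := hB4.
split=> [et2 et4 inj5|et1 inj2 inj4].
  apply: elem_essential => //; first exact: submodule_range.
  move=> b _ b0.
  have [r [[a4 _ t4a4] rb0]] :=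
    nonsingular_colon nsB3 (submodule_setT _) et4 (I : setT (g3 b)) b0.
  have f4a4 : kernel f4 a4.
    by apply: inj5; rewrite c4 t4a4 -linearZ g43 linear0.
  have [s [[a3 _ f3a3] srb0]] :=
    nonsingular_colon nsB3 (submodule_kernel _) eA4 f4a4 rb0.
  (* The lift [a3] need not map to the multiple of [b], but the error vanishes under [g3], so a
     multiple of it comes from [B2]. *)
  have g3b : kernel g3 (s *: (r *: b) - t3 a3).
    rewrite /kernel /= linearB -c3 f3a3 !linearZ /= t4a4.
    by rewrite -scalerDr subrr scaler0.
  have [u [[b2 _ g2b2] usrb0]] :=
    nonsingular_colon nsB3 (submodule_kernel _) eB3 g3b srb0.
  have [v [[a2 _ t2a2] vusrb0]] :=
    nonsingular_colon nsB3 (submodule_setT _) et2 (I : setT b2) usrb0.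
  (* A further multiple of the error is [t3 (f2 a2)]; adding back the matching multiple of [t3 a3]
     recovers the multiple of [b]. The product is taken in [R^c], so in [R] it reads r s u v. *)
  exists (v * u * s * r); rewrite -!scalerA; split=> //.
  exists (f2 a2 + v *: (u *: a3)) => //.
  rewrite linearD c2 t2a2 !linearZ /= g2b2 -scalerDr.
  by rewrite -scalerDr subrK.
suff sg : singular (kernel t3).
  by split=> // nsA3; apply/linear_inj_ker; apply: nonsingular_sub sg.
apply/seteqP; split=> a => [[]//|t3a]; split=> //.
have f3a : kernel f3 a.
  by apply: inj4; rewrite c3 t3a !linear0.
exists [set r : regular_rmod R | (r : R^c) *: a = 0] => //.
apply: elem_essential => //.
  apply/submoduleP; split=> /= [|r x y xa ya]; first by rewrite scale0r.
  by rewrite scalerDl -scalerA xa ya scaler0 addr0.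
(* The chase starts from [x *: a] rather than [a], and seeks a multiplier that kills it but not [x],
   an element of the non-singular module of [R] over itself. *)
move=> x _ x0.
have f3xa : kernel f3 ((x : R^c) *: a).
  exact: submoduleZ (submodule_kernel _) f3a.
have [r [[a2 _ f2a2] rx0]] :=
  nonsingular_colon hR (submodule_kernel _) eA3 f3xa x0.
have g2t2a2 : kernel g2 (t2 a2).
  by rewrite /kernel /= -c2 f2a2 !linearZ /= t3a !scaler0.
have [s [[b1 _ g1b1] srx0]] :=
  nonsingular_colon hR (submodule_kernel _) eB2 g2t2a2 rx0.
have [u [[a1 _ t1a1] usrx0]] :=
  nonsingular_colon hR (submodule_setT _) et1 (I : setT b1) srx0.
have f1a1 : f1 a1 = u *: (s *: a2).
  by apply: inj2; rewrite c1 t1a1 !linearZ /= g1b1.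
exists (u * s * r); rewrite -!scalerA; split=> //=.
(* Scaling in the regular module is the product of [R^c], so the multiple of [x] acts on [a] by
   successive scalings. The result is [f2 (f1 a1)], hence zero. *)
rewrite -[LHS]/((u * (s * (r * (x : R^c)))) *: a) -!scalerA.
by rewrite -f2a2 -!linearZ -f1a1 f21.
Qed.
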